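(* Let $N$ be a positive integer, $\boldsymbol{k}=(k_1,\dots,k_r)$ an index, and $\boldsymbol{x}=(x_1,\dots,x_r)$ indeterminates. When $k_1>1$, \[ \frac{\Delta^{(N)}\widetilde{\mathrm{Li}}_{\boldsymbol{k}}^{\sqcup\!\sqcup, (N)}(\boldsymbol{x})}{\Delta^{(N)}x_1}=-\frac{1}{x_1}\widetilde{\mathrm{Li}}_{\boldsymbol{k}^{\downarrow}_1}^{\sqcup\!\sqcup, (N)}(\boldsymbol{x}); \] when $r=1$ and $k_1=1$, \[ \frac{\Delta^{(N)}\widetilde{\mathrm{Li}}_{\boldsymbol{k}}^{\sqcup\!\sqcup, (N)}(\boldsymbol{x})}{\Delta^{(N)}x_1}=\frac{1}{x_1}-\frac{1}{x_1+N^{-1}-1}; \] when $r>1$ and $k_1=1$, \[ \frac{\Delta^{(N)}\widetilde{\mathrm{Li}}_{\boldsymbol{k}}^{\sqcup\!\sqcup, (N)}(\boldsymbol{x})}{\Delta^{(N)}x_1} = \frac{1}{x_1}\widetilde{\mathrm{Li}}_{\boldsymbol{k}^{\wedge}_1}^{\sqcup\!\sqcup, (N)}(\boldsymbol{x}^{\wedge}_1)-\frac{1}{x_1+N^{-1}-x_2}\left(\widetilde{\mathrm{Li}}_{\boldsymbol{k}^{\wedge}_1}^{\sqcup\!\sqcup, (N)}(\boldsymbol{x}^{\wedge}_1)-\widetilde{\mathrm{Li}}_{\boldsymbol{k}^{\wedge}_1}^{\sqcup\!\sqcup, (N)}(\boldsymbol{x}^{\wedge}_2)\bigg|_{x_1+N^{-1}}\right).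 \]
   Context: Here $\sqcup\!\sqcup$ denotes the shuffle symbol. With $x_{r+1}\coloneqq1$, \[ \widetilde{\mathrm{Li}}_{\boldsymbol{k}}^{\sqcup\!\sqcup,(N)}(\boldsymbol{x})\coloneqq\sum_{0<n_1<\cdots<n_r<N}\frac{1}{n_1^{k_1}\cdots n_r^{k_r}}\prod_{i=1}^{r}\frac{\binom{Nx_{i+1}-1}{n_i}}{\binom{Nx_i-1}{n_i}}. \] The difference quotient is $\frac{\Delta^{(N)}f(\boldsymbol{x})}{\Delta^{(N)}x_i}\coloneqq N\bigl(f(x_1,\dots,x_i+N^{-1},\dots,x_r)-f(\boldsymbol{x})\bigr)$, and $f(\boldsymbol{x})\big|_{x_i+N^{-1}}\coloneqq f(x_1,\dots,x_{i-1},x_i+N^{-1},x_{i+1},\dots,x_r)$. Notation: $\boldsymbol{k}^{\wedge}_i=(k_1,\dots,k_{i-1},k_{i+1},\dots,k_r)$, $\boldsymbol{k}^{\downarrow}_i=(k_1,\dots,k_{i-1},k_i-1,k_{i+1},\dots,k_r)$ (for $k_i>1$), $\boldsymbol{x}^{\wedge}_i=(x_1,\dots,x_{i-1},x_{i+1},\dots,x_r)$. *)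

(* Defs.v *)
From HB Require Import structures.
From mathcomp Require Import all_boot all_order all_algebra.
From mathcomp Require Import mpoly.

Set Implicit Arguments.
Unset Strict Implicit.
Unset Printing Implicit Defensive.

Import GRing.Theory.
Local Open Scope ring_scope.

(* Tuples (a_1, ..., a_r) are functions on 'I_r, so a_i is [a] at the ordinal *)
(* of value i - 1; in particular the first entry is at [ord0].                *)

Definition is_index (r : nat) (k : 'I_r -> nat) : Prop :=
  forall i, (0 < k i)%N.

Definition omit (T : Type) (r : nat) (i : 'I_r.+1) (a : 'I_r.+1 -> T) :
  'I_r -> T := fun j => a (lift i j).

(* Truncated predecessor: only meaningful when 1 < k i. *)
Definition lower (r : nat) (i : 'I_r) (k : 'I_r -> nat) : 'I_r -> nat :=
  fun j => if j == i then (k j).-1 else k j.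

Definition gbinom (K : fieldType) (a : K) (n : nat) : K :=
  (\prod_(j < n) (a - j%:R)) / (n`!)%:R.

(* The entry x_{i+1}, with the convention x_{r+1} = 1. *)
Definition next_entry (K : fieldType) (r : nat) (x : 'I_r -> K) (i : 'I_r) : K :=
  oapp x 1 (insub i.+1).

Definition increasing_pos (N r : nat) (n : {ffun 'I_r -> 'I_N}) : bool :=
  [forall i : 'I_r, (0 < n i)%N]
  && [forall i : 'I_r, forall j : 'I_r, (i < j)%N ==> (n i < n j)%N].

Definition Li_sh (K : fieldType) (N r : nat) (k : 'I_r -> nat)
    (x : 'I_r -> K) : K :=
  \sum_(n : {ffun 'I_r -> 'I_N} | increasing_pos n)
     (1 / \prod_(i < r) (n i)%:R ^+ k i) *
     \prod_(i < r) (gbinom (N%:R * next_entry x i - 1) (n i)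
                    / gbinom (N%:R * x i - 1) (n i)).

Definition shift_at (K : fieldType) (N r : nat) (i : 'I_r)
    (f : ('I_r -> K) -> K) (x : 'I_r -> K) : K :=
  f (fun j => if j == i then x j + N%:R^-1 else x j).

Definition diff_quot (K : fieldType) (N r : nat) (i : 'I_r)
    (f : ('I_r -> K) -> K) (x : 'I_r -> K) : K :=
  N%:R * (shift_at N i f x - f x).

(* The generic point (x_1, ..., x_r) over the field F(x_1, ..., x_r). When F  *)
(* has characteristic 0, no denominator in [Li_sh] vanishes there, and        *)
(* substituting x_i + 1/N for x_i in a rational function amounts to           *)
(* evaluating it at the shifted point.                                        *)
Definition indet (F : fieldType) (r : nat) : 'I_r -> {fraction {mpoly F[r]}} :=
  fun i => tofrac ('X_i : {mpoly F[r]}).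

(* Main.v *)
(* The variable x_1 enters the summand only through 1 / binom(N x_1 - 1, n_1).
   Since binom(A + 1, n) (A + 1 - n) = (A + 1) binom(A, n) with A = N x_1 - 1,
   the difference quotient multiplies each summand by - n_1 / x_1, i.e. lowers
   k_1 by one. When k_1 = 1, the inner sum over 0 < n_1 < n_2 of the ratios
   binom(B, n_1) / binom(A, n_1), with B = N x_2 - 1, telescopes:
     (A + 1 - B) \sum_(0 <= n < m) binom(B, n) / binom(A, n)
     = (A + 1) (1 - binom(B, m) / binom(A + 1, m)).
   For r = 1 the same formula applies with m = N and B = N - 1, where
   binom(B, m) = 0. *)

Require Import Defs.
From HB Require Import structures.
From mathcomp Require Import all_boot all_order all_algebra.
From mathcomp Require Import mpoly ring.

Set Implicit Arguments.
Unset Strict Implicit.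
Unset Printing Implicit Defensive.

Import GRing.Theory.
Local Open Scope ring_scope.

Lemma pchar0_natr_eq0 (K : fieldType) (charK : [pchar K] =i pred0) n :
  (n%:R == 0 :> K) = (n == 0%N).
Proof. by move: n; apply/pcharf0P. Qed.

(** * Generalized binomial coefficients and the telescoping sum *)

Section GeneralizedBinomial.

Variable K : fieldType.
Hypothesis charK : [pchar K] =i pred0.
Implicit Types (a b : K) (n m : nat).

Lemma gbinom0 a : gbinom a 0 = 1.
Proof. by rewrite /gbinom big_ord0 fact0 divr1. Qed.

Lemma gbinomS a n : gbinom a n.+1 = gbinom a n * ((a - n%:R) / n.+1%:R).
Proof.
by rewrite /gbinom big_ord_recr factS natrM invfM /= [_^-1 * _]mulrC mulrACA.
Qed.

Lemma gbinom_pred_diag n : (0 < n)%N -> gbinom (n%:R - 1 : K) n = 0.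
Proof.
by case: n => // n _; rewrite gbinomS -natr1 addrK subrr mul0r mulr0.
Qed.

Lemma gbinom_neq0 a n : (forall j, a != j%:R) -> gbinom a n != 0.
Proof.
move=> a_nat; elim: n => [|n IHn]; first by rewrite gbinom0 oner_neq0.
rewrite gbinomS mulf_neq0 //.
by rewrite mulf_neq0 ?subr_eq0 // invr_eq0 (pchar0_natr_eq0 charK).
Qed.

(** Both sides are (a + 1) a (a - 1) ... (a + 1 - n) / n!. *)
Lemma gbinom_addr1 a n :
  (a + 1 - n%:R) * gbinom (a + 1) n = (a + 1) * gbinom a n.
Proof.
elim: n => [|n IHn]; first by rewrite !gbinom0 subr0.
have Sn : n.+1%:R != 0 :> K by rewrite (pchar0_natr_eq0 charK).
rewrite !gbinomS [RHS]mulrA -IHn -natr1; move: Sn; rewrite -natr1 => Sn.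
by field.
Qed.

(** The reciprocal form of [gbinom_addr1]; keeping a + 1 off the naturals makes both binomials
    nonzero. *)
Lemma invr_gbinom_addr1 a n : (forall j, a + 1 != j%:R) ->
  (a + 1) / gbinom (a + 1) n = (a + 1 - n%:R) / gbinom a n.
Proof.
move=> a1_nat.
have a_nat j : a != j%:R.
  by apply: contra (a1_nat j.+1) => /eqP->; rewrite natr1.
apply/eqP; rewrite eqr_div ?gbinom_neq0 //.
by rewrite -gbinom_addr1.
Qed.

Lemma sum_gbinom_ratio a b m : (forall j, a + 1 != j%:R) ->
  (a + 1 - b) * (\sum_(0 <= n < m) gbinom b n / gbinom a n)
  = (a + 1) * (1 - gbinom b m / gbinom (a + 1) m).
Proof.
move=> a1_nat; elim: m => [|m IHm].
  by rewrite big_geq // !gbinom0 divr1 subrr !mulr0.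
have Sm : m.+1%:R != 0 :> K by rewrite (pchar0_natr_eq0 charK).
have am : a + 1 - m%:R != 0 by rewrite subr_eq0.
have step : gbinom b m.+1 / gbinom (a + 1) m.+1
    = gbinom b m / gbinom (a + 1) m * ((b - m%:R) / (a + 1 - m%:R)).
  have gm := gbinom_neq0 m a1_nat.
  rewrite !gbinomS; move: Sm; rewrite -natr1 => Sm; field.
  by rewrite am gm Sm.
rewrite big_nat_recr //= mulrDr IHm step.
(* With u and v the ratios over binom(a + 1, m) and binom(a, m), this is (a + 1) u = (a + 1 - m) v.
   It brings both sides of the induction step to a + 1 - (b - m) v. *)
have: (a + 1) * (gbinom b m / gbinom (a + 1) m)
      = (a + 1 - m%:R) * (gbinom b m / gbinom a m).
  by rewrite mulrCA invr_gbinom_addr1 // mulrCA.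
move: (_ / gbinom a m) (_ / gbinom (a + 1) m) => v u uv.
by rewrite !mulrBr (mulrA _ u) !uv; field.
Qed.

End GeneralizedBinomial.

(** * Separating the first summation index from the others *)

Section Recursion.

Variables (K : fieldType) (N : nat).

Definition Li_sh_term (r : nat) (k : 'I_r -> nat) (x : 'I_r -> K)
    (n : {ffun 'I_r -> 'I_N}) : K :=
  (1 / \prod_(i < r) (n i)%:R ^+ k i) *
  \prod_(i < r) (gbinom (N%:R * next_entry x i - 1) (n i)
                 / gbinom (N%:R * x i - 1) (n i)).

Lemma Li_shE r (k : 'I_r -> nat) (x : 'I_r -> K) :
  Li_sh N k x
  = \sum_(n : {ffun 'I_r -> 'I_N} | increasing_pos n) Li_sh_term k x n.
Proof. by []. Qed.

(* The first entry of [n], with the convention n_{r+1} = N. *)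
Definition first_or_N (r : nat) (n : {ffun 'I_r -> 'I_N}) : nat :=
  oapp (fun i => n i : nat) N (insub 0%N).

(** Prepends n_1 to (n_2, ..., n_r). With inverse [ffun_uncons], it reindexes the multiple sum by
    pairs. *)
Definition ffun_cons (r : nat) (p : 'I_N * {ffun 'I_r -> 'I_N}) :
    {ffun 'I_r.+1 -> 'I_N} :=
  [ffun i => oapp p.2 p.1 (unlift ord0 i)].

Definition ffun_uncons (r : nat) (n : {ffun 'I_r.+1 -> 'I_N}) :
    'I_N * {ffun 'I_r -> 'I_N} :=
  (n ord0, [ffun i => n (lift ord0 i)]).

Lemma ffun_cons0 r (p : 'I_N * {ffun 'I_r -> 'I_N}) : ffun_cons p ord0 = p.1.
Proof. by rewrite ffunE unlift_none. Qed.

Lemma ffun_cons_lift r (p : 'I_N * {ffun 'I_r -> 'I_N}) i :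
  ffun_cons p (lift ord0 i) = p.2 i.
Proof. by rewrite ffunE liftK. Qed.

Lemma ffun_consK r : cancel (@ffun_cons r) (@ffun_uncons r).
Proof.
move=> [m n]; rewrite /ffun_uncons ffun_cons0; congr (_, _).
by apply/ffunP => i; rewrite ffunE ffun_cons_lift.
Qed.

Lemma ffun_unconsK r : cancel (@ffun_uncons r) (@ffun_cons r).
Proof.
move=> n; apply/ffunP => i.
by case: (unliftP ord0 i) => [j|] ->;
  rewrite ?ffun_cons_lift ?ffun_cons0 ?ffunE.
Qed.

(** By transitivity, the new head need only be compared with the head of the tail. For an empty tail
    the bound N holds by the type of [m]. *)
Lemma increasing_pos_cons r (m : 'I_N) (n : {ffun 'I_r -> 'I_N}) :
  increasing_pos (ffun_cons (m, n))
  = increasing_pos n && (0 < m < first_or_N n)%N.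
Proof.
apply/idP/idP.
  case/andP=> /forallP pos /forallP incr.
  have incr' (i j : 'I_r.+1) : (i < j)%N ->
      (ffun_cons (m, n) i < ffun_cons (m, n) j)%N.
    by move: (incr i) => /forallP/(_ j)/implyP.
  apply/andP; split; [apply/andP; split|apply/andP; split].
  - by apply/forallP => i; move: (pos (lift ord0 i)); rewrite ffun_cons_lift.
  - apply/forallP => i; apply/forallP => j; apply/implyP => ij.
    by move: (incr' (lift ord0 i) (lift ord0 j) ij); rewrite !ffun_cons_lift.
  - by move: (pos ord0); rewrite ffun_cons0.
  - rewrite /first_or_N; case: insubP => [j _ j0|_] /=; last exact: ltn_ord.
    by move: (incr' ord0 (lift ord0 j) isT); rewrite ffun_cons0 ffun_cons_lift.
case/andP=> /andP[/forallP pos /forallP incr] /andP[m_gt0 m_lt].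
have incr' (i j : 'I_r) : (i < j)%N -> (n i < n j)%N.
  by move: (incr i) => /forallP/(_ j)/implyP.
have m_lt' j : (m < n j)%N.
  case: r n pos incr incr' m_lt j => [|r] n pos incr incr' m_lt j.
    by case: j.
  move: m_lt; rewrite /first_or_N; case: insubP => [l _ l0 /= ml|//].
  case: (posnP j) => [j0|j_gt0].
    by rewrite (_ : j = l) //; apply: val_inj; rewrite /= j0 l0.
  by apply: ltn_trans ml _; apply: incr'; rewrite l0.
apply/andP; split.
  apply/forallP => i.
  by case: (unliftP ord0 i) => [j|] ->; rewrite ?ffun_cons_lift ?ffun_cons0.
apply/forallP => i; apply/forallP => j; apply/implyP.
case: (unliftP ord0 i) => [i'|] ->; case: (unliftP ord0 j) => [j'|] -> //;
  rewrite ?ffun_cons_lift ?ffun_cons0 //.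
by move=> ij; apply: incr'.
Qed.

(** Dropping the head preserves the convention x_{r+1} = 1, so the tail of a summand is again a
    summand. *)
Lemma next_entry_omit r (x : 'I_r.+1 -> K) i :
  next_entry (omit ord0 x) i = next_entry x (lift ord0 i).
Proof.
rewrite /next_entry.
case: insubP => [j ir ji|ir]; case: insubP => [l lr li|lr] //=.
- rewrite /omit; congr x; apply: val_inj.
  by rewrite /= li /= /bump /= ji.
- by move: lr; rewrite /= /bump /= ltnS ir.
- by move: lr ir; rewrite /= /bump /= ltnS => ->.
Qed.

Lemma next_entry_eq_behead r (y z : 'I_r.+1 -> K) :
    (forall i, y (lift ord0 i) = z (lift ord0 i)) ->
  next_entry y =1 next_entry z.
Proof.
move=> yz i; rewrite /next_entry; case: insubP => [j _ ji|_] //=.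
by case: (unliftP ord0 j) ji => [j'|] -> //=; rewrite yz.
Qed.

(** The first variable occurs only in the denominator of the first ratio, since [next_entry] never
    reads it. This will compare the arguments (x_2, x_3, ...) and (x_1 + 1/N, x_3, ...). *)
Lemma Li_sh_term_change_head r (k : 'I_r.+1 -> nat) (y z : 'I_r.+1 -> K)
    (n : {ffun 'I_r.+1 -> 'I_N}) :
    (forall i, y (lift ord0 i) = z (lift ord0 i)) ->
    gbinom (N%:R * z ord0 - 1) (n ord0) != 0 ->
  Li_sh_term k y n
  = gbinom (N%:R * z ord0 - 1) (n ord0) / gbinom (N%:R * y ord0 - 1) (n ord0)
    * Li_sh_term k z n.
Proof.
move=> yz z_neq0; rewrite /Li_sh_term [RHS]mulrCA; congr (_ * _).
rewrite !big_ord_recl mulrA; congr (_ * _).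
  by rewrite (next_entry_eq_behead yz) [RHS]mulrC mulrA divfK.
by apply: eq_bigr => i _; rewrite (next_entry_eq_behead yz) yz.
Qed.

Lemma Li_sh_term_cons r (k : 'I_r.+1 -> nat) (x : 'I_r.+1 -> K)
    (m : 'I_N) (n : {ffun 'I_r -> 'I_N}) :
  Li_sh_term k x (ffun_cons (m, n))
  = (m%:R ^+ k ord0)^-1
    * (gbinom (N%:R * next_entry x ord0 - 1) m
       / gbinom (N%:R * x ord0 - 1) m)
    * Li_sh_term (omit ord0 k) (omit ord0 x) n.
Proof.
rewrite /Li_sh_term !big_ord_recl !ffun_cons0 /= !div1r invfM mulrACA.
congr (_ * (_ * _)).
  by congr (_^-1); apply: eq_bigr => i _; rewrite ffun_cons_lift.
by apply: eq_bigr => i _; rewrite ffun_cons_lift next_entry_omit.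
Qed.

Lemma first_or_N_leq r (n : {ffun 'I_r -> 'I_N}) : (first_or_N n <= N)%N.
Proof.
rewrite /first_or_N; case: insubP => [j _ _|_] //=; exact: ltnW (ltn_ord _).
Qed.

Lemma Li_sh_recl r (k : 'I_r.+1 -> nat) (x : 'I_r.+1 -> K) :
  Li_sh N k x
  = \sum_(n : {ffun 'I_r -> 'I_N} | increasing_pos n)
      (\sum_(1 <= m < first_or_N n)
         (m%:R ^+ k ord0)^-1
         * (gbinom (N%:R * next_entry x ord0 - 1) m
            / gbinom (N%:R * x ord0 - 1) m))
      * Li_sh_term (omit ord0 k) (omit ord0 x) n.
Proof.
rewrite /Li_sh (reindex (@ffun_cons r)) /=; last first.
  by exists (@ffun_uncons r) => p _; rewrite ?ffun_consK ?ffun_unconsK.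
rewrite (eq_bigl (fun p : 'I_N * {ffun 'I_r -> 'I_N} =>
                    increasing_pos p.2 && (0 < p.1 < first_or_N p.2)%N));
  last by case=> m n; rewrite increasing_pos_cons.
rewrite (eq_bigr (fun p : 'I_N * {ffun 'I_r -> 'I_N} =>
                    Li_sh_term k x (ffun_cons (p.1, p.2))));
  last by case.
rewrite [LHS]big_mkcond /=.
rewrite -(pair_bigA _ (fun (m : 'I_N) n =>
  if increasing_pos n && (0 < m < first_or_N n)%N
  then Li_sh_term k x (ffun_cons (m, n)) else 0)) /=.
rewrite exchange_big [RHS]big_mkcond /=; apply: eq_bigr => n _.
case: (increasing_pos n); last by rewrite big1.
rewrite -big_mkcond /= mulr_suml.
(* The range of m is widened to 0 <= m < N, with the bounds turned into a condition, to match a sum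
   over ['I_N]. *)
rewrite (big_nat_widen _ _ _ _ _ (first_or_N_leq n)).
rewrite (@big_nat_widenl _ _ _ 1 0) //= big_mkord.
apply: eq_big => [m|m _]; first by rewrite andbC.
exact: Li_sh_term_cons.
Qed.

End Recursion.

(** * The difference quotient at a point avoiding the poles *)

Section DifferenceQuotient.

Variables (K : fieldType) (N : nat).
Hypothesis (charK : [pchar K] =i pred0) (N_gt0 : (0 < N)%N).

Let N_neq0 : N%:R != 0 :> K.
Proof. by rewrite (pchar0_natr_eq0 charK) -lt0n. Qed.

(** A step of 1/N in the variable is a unit step in the upper argument of the binomial. *)
Lemma mulrN_shift (a : K) : N%:R * (a + N%:R^-1) - 1 = N%:R * a - 1 + 1.
Proof. by rewrite mulrDr divff // addrK subrK. Qed.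

(** The case k_1 = 1 is included: the lowered exponent is then 0, and the resulting sum is evaluated
    in [diff_quot_Li_sh1]. *)
Lemma diff_quot_Li_sh r (k : 'I_r.+1 -> nat) (x : 'I_r.+1 -> K) :
    (0 < k ord0)%N -> (forall j, N%:R * x ord0 != j%:R) ->
  diff_quot N ord0 (Li_sh N k) x
  = - (1 / x ord0) * Li_sh N (lower ord0 k) x.
Proof.
move=> k_gt0 x_nat; rewrite /diff_quot /shift_at.
set y := fun j : 'I_r.+1 => _; rewrite !Li_sh_recl.
rewrite -sumrB !mulr_sumr; apply: eq_bigr => n _.
have yx i : y (lift ord0 i) = x (lift ord0 i) by [].
have -> : Li_sh_term (omit ord0 k) (omit ord0 y) n
          = Li_sh_term (omit ord0 k) (omit ord0 x) n by [].
rewrite -mulrBl [LHS]mulrA [RHS]mulrA; congr (_ * _).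
rewrite -sumrB !mulr_sumr; apply: eq_big_nat => m /andP[m_gt0 _].
rewrite (next_entry_eq_behead yx).
rewrite /y /lower !eqxx mulrN_shift.
set b := gbinom _ _; set a := N%:R * x ord0 - 1.
have a1 : a + 1 = N%:R * x ord0 by rewrite subrK.
have a1_nat j : a + 1 != j%:R by rewrite a1.
have x_neq0 : x ord0 != 0.
  by move: (x_nat 0%N); rewrite mulf_eq0 negb_or => /andP[].
have m_neq0 : m%:R != 0 :> K by rewrite (pchar0_natr_eq0 charK) -lt0n.
(* With a + 1 = N x_1, the difference of reciprocals is - m / (N x_1) times 1 / binom(a, m). *)
have -> : (gbinom (a + 1) m)^-1
    = (a + 1)^-1 * ((a + 1 - m%:R) / gbinom a m).
  by rewrite -(invr_gbinom_addr1 charK) // mulKf // (a1_nat 0%N).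
rewrite a1 -{1 2}(prednK k_gt0) exprS.
have [A_neq0 B_neq0] : gbinom a m != 0 /\ m%:R ^+ (k ord0).-1 != 0 :> K.
  rewrite expf_neq0 // gbinom_neq0 // => j.
  by apply: contra (a1_nat j.+1) => /eqP->; rewrite natr1.
by field; rewrite A_neq0 B_neq0 x_neq0 m_neq0 N_neq0.
Qed.

Lemma diff_quot_Li_sh1 r (k : 'I_r.+1 -> nat) (x : 'I_r.+1 -> K) :
    k ord0 = 1%N -> (forall j, N%:R * x ord0 != j%:R) ->
    x ord0 + N%:R^-1 - next_entry x ord0 != 0 ->
  diff_quot N ord0 (Li_sh N k) x
  = \sum_(n : {ffun 'I_r -> 'I_N} | increasing_pos n)
     (1 / x ord0 - 1 / (x ord0 + N%:R^-1 - next_entry x ord0)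
        * (1 - gbinom (N%:R * next_entry x ord0 - 1) (first_or_N n)
               / gbinom (N%:R * (x ord0 + N%:R^-1) - 1) (first_or_N n)))
     * Li_sh_term (omit ord0 k) (omit ord0 x) n.
Proof.
move=> k1 x_nat; set b := next_entry x ord0 => xb_neq0.
rewrite diff_quot_Li_sh ?k1 // Li_sh_recl mulr_sumr.
apply: eq_bigr => n /andP[/forallP n_pos _].
have -> : Li_sh_term (omit ord0 (lower ord0 k)) (omit ord0 x) n
          = Li_sh_term (omit ord0 k) (omit ord0 x) n by [].
rewrite mulrA; congr (_ * _).
rewrite /lower eqxx k1 /=.
under eq_bigr => m _ do rewrite expr0 invr1 mul1r.
have m_gt0 : (0 < first_or_N n)%N.
  by rewrite /first_or_N; case: insubP => [j _ _|_] //=.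
move: (first_or_N n) m_gt0 => m m_gt0.
rewrite mulrN_shift; set a := N%:R * x ord0 - 1.
have a1 : a + 1 = N%:R * x ord0 by rewrite subrK.
have a1_nat j : a + 1 != j%:R by rewrite a1.
(* The telescoping sum starts at 0 and the inner sum at 1. The extra term, equal to 1, is the source
   of the summand 1 / x_1. *)
have := sum_gbinom_ratio charK (N%:R * b - 1) m a1_nat.
rewrite (big_ltn m_gt0) !gbinom0 divr1 -/b.
move: (gbinom (N%:R * b - 1) m / _) => u.
move: (\sum_(1 <= i < m) _) => s E.
have x_neq0 : x ord0 != 0.
  by move: (x_nat 0%N); rewrite mulf_eq0 negb_or => /andP[].
have D : a + 1 - (N%:R * b - 1) = N%:R * (x ord0 + N%:R^-1 - b).
  by rewrite a1; field.
move: (x ord0 + _ - b) xb_neq0 D => d d_neq0 D.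
have -> : s = x ord0 * (1 - u) / d - 1.
  apply: (addrI 1); rewrite [RHS]addrC subrK.
  apply: (mulfI (mulf_neq0 N_neq0 d_neq0)); rewrite -[in LHS]D E a1.
  by field.
by field; rewrite d_neq0 x_neq0.
Qed.

End DifferenceQuotient.

(** * Nonvanishing at the generic point *)

Section GenericPoint.

Variables (F : fieldType) (r : nat).
Hypothesis charF : [pchar F] =i pred0.

Lemma pchar_frac_mpoly : [pchar {fraction {mpoly F[r]}}] =i pred0.
Proof.
apply/pcharf0P => n.
rewrite -(rmorph_nat (@tofrac {mpoly F[r]})) tofrac_eq0.
by rewrite -(rmorph_nat (@mpolyC r F)) mpolyC_eq0 (pchar0_natr_eq0 charF).
Qed.

(** The coefficients of X_i differ: N on the left, nonzero in characteristic 0, and 0 on the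
    right. *)
Lemma indet_neq N (i : 'I_r) (p : {mpoly F[r]}) : (0 < N)%N ->
  p@_U_(i) = 0 -> N%:R * indet F i != tofrac p.
Proof.
move=> N_gt0 pi; rewrite /indet -(rmorph_nat (@tofrac {mpoly F[r]})) -rmorphM.
rewrite tofrac_eq; apply/eqP => /(congr1 (mcoeff U_(i)%MM)) /eqP.
rewrite pi mulr_natl mcoeffMn mcoeffX eqxx (pchar0_natr_eq0 charF).
by rewrite -leqn0 leqNgt N_gt0.
Qed.

Lemma indet_neq_nat N (i : 'I_r) j : (0 < N)%N -> N%:R * indet F i != j%:R.
Proof.
move=> N_gt0; rewrite -[j%:R](rmorph_nat (@tofrac {mpoly F[r]})) indet_neq //.
by rewrite -(rmorph_nat (@mpolyC r F)) mcoeffC mnm1_eq0 mulr0.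
Qed.

End GenericPoint.

(** * The three cases at the generic point *)

Theorem theorem3p1 (F : fieldType) (charF : [pchar F] =i pred0)
    (N : nat) (N_gt0 : (0 < N)%N) :
  (forall (r : nat) (k : 'I_r.+1 -> nat), is_index k -> (1 < k ord0)%N ->
     let x := indet F (r := r.+1) in
     diff_quot N ord0 (Li_sh N k) x
     = - (1 / x ord0) * Li_sh N (lower ord0 k) x)
  /\
  (forall (k : 'I_1 -> nat), is_index k -> k ord0 = 1%N ->
     let x := indet F (r := 1) in
     diff_quot N ord0 (Li_sh N k) x
     = 1 / x ord0 - 1 / (x ord0 + N%:R^-1 - 1))
  /\
  (forall (r : nat) (k : 'I_r.+2 -> nat), is_index k -> k ord0 = 1%N ->
     let x := indet F (r := r.+2) in
     let i2 : 'I_r.+2 := lift ord0 ord0 in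
     diff_quot N ord0 (Li_sh N k) x
     = 1 / x ord0 * Li_sh N (omit ord0 k) (omit ord0 x)
       - 1 / (x ord0 + N%:R^-1 - x i2) *
         (Li_sh N (omit ord0 k) (omit ord0 x)
          - shift_at N ord0 (Li_sh N (omit ord0 k)) (omit i2 x))).
Proof.
split; last split.
- move=> r k k_pos _ x; have charK := pchar_frac_mpoly r.+1 charF.
  by apply: diff_quot_Li_sh => // j; apply: indet_neq_nat.
- move=> k _ k1 x; have charK := pchar_frac_mpoly 1 charF.
  have N_neq0 : N%:R != 0 :> {fraction {mpoly F[1]}}.
    by rewrite (pchar0_natr_eq0 charK) -lt0n.
  have x_nat j : N%:R * x ord0 != j%:R by apply: indet_neq_nat.
  have next1 : next_entry x ord0 = 1 by rewrite /next_entry insubF.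
  rewrite diff_quot_Li_sh1 // next1; last first.
    (* If x_1 + 1/N = 1, then N x_1 is the natural number N - 1. *)
    apply: contra (x_nat N.-1) => /eqP E; apply/eqP.
    have -> : x ord0 = 1 - N%:R^-1.
      by apply/eqP; rewrite -subr_eq0 opprB addrA E.
    by rewrite mulrBr mulr1 divff // -[in LHS](prednK N_gt0) -natr1 addrK.
  (* The outer sum has a single term, the empty tuple, with summand 1 and bound N for n_1. *)
  have one_ffun : #|{ffun 'I_0 -> 'I_N}| = 1%N by rewrite card_ffun !card_ord.
  have term1 (n : {ffun 'I_0 -> 'I_N}) :
      Li_sh_term (omit ord0 k) (omit ord0 x) n = 1.
    by rewrite /Li_sh_term !big_ord0 divr1 mulr1.
  rewrite (eq_big predT (fun=> 1 / x ord0 - 1 / (x ord0 + N%:R^-1 - 1))).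
  + by rewrite sumr_const one_ffun.
  + by move=> n; apply/andP; split; apply/forallP; case.
  + move=> n _; rewrite term1 mulr1 /first_or_N insubF //=.
    by rewrite !mulr1 gbinom_pred_diag // mul0r subr0 mulr1.
- move=> r k _ k1 x i2; have charK := pchar_frac_mpoly r.+2 charF.
  have N_neq0 : N%:R != 0 :> {fraction {mpoly F[r.+2]}}.
    by rewrite (pchar0_natr_eq0 charK) -lt0n.
  have x_nat i j : N%:R * x i != j%:R by apply: indet_neq_nat.
  have next2 : next_entry x ord0 = x i2.
    rewrite /next_entry; case: insubP => [j _ j1|//] /=.
    by congr x; apply: val_inj.
  rewrite diff_quot_Li_sh1 // next2; last first.
    (* If x_1 + 1/N = x_2, then N x_1 = N x_2 - 1, a polynomial without X_1. *)
    have /negP : N%:R * x ord0 != tofrac (N%:R * 'X_i2 - 1 : {mpoly F[r.+2]}).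
      apply: indet_neq => //.
      rewrite mcoeffB mulr_natl mcoeffMn mcoeffX mcoeff1 mnm1_eq0 subr0.
      by rewrite eq_mnm1 mul0rn.
    have -> : tofrac (N%:R * 'X_i2 - 1 : {mpoly F[r.+2]}) = N%:R * x i2 - 1.
      by rewrite rmorphB rmorphM rmorph_nat rmorph1.
    move=> H; apply/eqP => E; apply: H.
    have -> : x i2 = x ord0 + N%:R^-1.
      by apply/eqP; rewrite eq_sym -subr_eq0 E.
    by rewrite mulrDr divff // addrK.
  rewrite /shift_at; set y := fun j : 'I_r.+1 => if _ then _ else _.
  (* The boundary ratio left by telescoping is exactly the factor replacing x_2 by x_1 + 1/N at the
     head of the tail summand. *)
  have termy (n : {ffun 'I_r.+1 -> 'I_N}) : Li_sh_term (omit ord0 k) y n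
      = gbinom (N%:R * x i2 - 1) (first_or_N n)
        / gbinom (N%:R * (x ord0 + N%:R^-1) - 1) (first_or_N n)
        * Li_sh_term (omit ord0 k) (omit ord0 x) n.
    have y0 : y ord0 = x ord0 + N%:R^-1.
      by rewrite /y eqxx /omit; congr (x _ + _); apply: val_inj.
    have n0 : first_or_N n = n ord0.
      rewrite /first_or_N; case: insubP => [l _ l0|//] /=.
      by congr (n _ : nat); apply: val_inj.
    rewrite n0 -y0; apply: Li_sh_term_change_head => [i|].
      by rewrite /y /omit; congr x; apply: val_inj.
    apply: gbinom_neq0 => // j; rewrite subr_eq -[1]/(1%:R) -natrD.
    exact: x_nat.
  rewrite !Li_shE -sumrB !mulr_sumr -sumrB; apply: eq_bigr => n _.
  rewrite termy; move: (_ / gbinom _ _) (Li_sh_term _ _ _) => u t.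
  move: (1 / x ord0) (1 / _) => c d.
  by ring.
Qed.
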